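(* Let $X$ be an $E$-valued $\mathcal P$-polynomial process with action $T$ and suppose the standing assumption (A') in the context holds. Let $p\in\mathcal C\cap \mathcal P_2$. Then $$ M^p_t := p(X_t) - \int_0^t \mathcal G p(X_r)\, dr,\quad t\geq 0, $$ defines a martingale with $\mathbb E[|M^p_t|^2]<\infty$ for any $t\geq 0$.
   Context: $\mathbb N=\{0,1,2,\dots\}$, $\mathbb R_+=[0,\infty)$, and the scalar field is $\mathbb F=\mathbb R$. $(\Omega,\mathfrak A,(\mathcal F_t)_{t\ge 0},P)$ is a filtered probability space and $E$ is a non-empty set. Polynomials: $\mathcal P$ is a vector space of functions $E\to\mathbb F$ containing all constant functions, together with a degree function $\deg:\mathcal P\to\mathbb N$ such that $\deg(p+q)\le\max\{\deg(p),\deg(q)\}$, $\deg(\lambda p)=\deg(p)$ for $p,q\in\mathcal P$, $\lambda\in\mathbb F\setminus\{0\}$, and $\deg(p)=0$ iff $p$ is constant. $\mathcal P_n:=\{p\in\mathcal P:\deg(p)\le n\}$. Polynomial action: a family $T=(T_h)_{h\ge0}$ of linear operators on $\mathcal P$ with $\deg(T_hp)\le\deg(p)$, $T_0p=p$, $T_hT_k=T_{h+k}$ for $h,k\ge0$, and $h\mapsto (T_hp)(x)$ right-continuous for all $p\in\mathcal P$, $x\in E$. Polynomial process: a function $X:\Omega\times\mathbb R_+\to E$ is an $E$-valued $\mathcal P$-polynomial process with action $T$ if for all $p\in\mathcal P$: $\mathbb E[|p(X_t)|]<\infty$ for $t\ge0$; $\mathbb E[p(X_{t+h})|\mathcal F_t]=T_hp(X_t)$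 for $t,h\ge0$; $t\mapsto p(X_t)$ has càdlàg paths; $p(X_t)$ is $\mathcal F_t$-measurable for $t\ge0$. Standing assumption (A'): there is a complete norm $\|\cdot\|$ on $\mathcal P_4$ such that (1) $(T_h|_{\mathcal P_4})_{h\ge0}$ is a strongly continuous semigroup of bounded operators; (2) $\delta_x:\mathcal P_4\to\mathbb F$, $f\mapsto f(x)$ is continuous for every $x\in E$; (3) the linear functional $\Gamma:\mathcal P_4\to\mathbb F$, $p\mapsto\mathbb E[p(X_0)]$ is continuous. Also: (4) $\mathcal P_1$ separates the points of $E$; (5) $\mathbb F=\mathbb R$; (6) $\mathcal P_1\cdot\mathcal P_1\subseteq\mathcal P_2$ and $\mathcal P_2\cdot\mathcal P_2\subseteq\mathcal P_4$ (pointwise products). The subspaces $\mathcal P_n$, $n=0,\dots,4$, are closed (and $T$-invariant). $\mathcal C\subseteq\mathcal P_4$ is the domain of the generator of the strongly continuous semigroup $(T_h|_{\mathcal P_4})_{h\ge0}$, and for $p\in\mathcal C$, $\mathcal Gp=\lim_{h\searrow0}\frac{T_hp-p}{h}\in\mathcal P_4$ is that generator; $\mathcal Gp\in\mathcal P_n$ for $p\in\mathcal C\cap\mathcal P_n$. *)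

(* Defs.v *)
From HB Require Import structures.
From mathcomp Require Import all_boot all_order all_algebra.
From mathcomp Require Import all_classical all_reals all_analysis.

Set Implicit Arguments.
Unset Strict Implicit.
Unset Printing Implicit Defensive.
Import Order.TTheory GRing.Theory Num.Theory.
Import numFieldNormedType.Exports.

Local Open Scope classical_set_scope.
Local Open Scope ring_scope.

Record filtration d (Omega : measurableType d) (R : realType)
    (F : R -> set (set Omega)) : Prop := {
  filtration_sigma_algebra : forall t, 0 <= t -> sigma_algebra setT (F t) ;
  filtration_sub : forall t, 0 <= t -> F t `<=` measurable ;
  filtration_mono : forall s t, 0 <= s -> s <= t -> F s `<=` F t }.

(** When [G] is a sigma-algebra, the measurable sets of [g_sigma_algebraType G]
    are exactly the members of [G]. *)
Definition measurable_wrt (Omega : pointedType) (R : realType)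
    (G : set (set Omega)) (f : Omega -> R) : Prop :=
  measurable_fun setT (f : g_sigma_algebraType G -> R).

(** [Z] is a version of the conditional expectation of [Y] given [G]; the
    almost sure equation [E[Y | G] = Z], for a [G]-measurable [Z], means that
    this holds. *)
Definition is_cond_expectation d (Omega : measurableType d) (R : realType)
    (P : probability Omega R) (G : set (set Omega)) (Y Z : Omega -> R) : Prop :=
  [/\ P.-integrable setT (EFin \o Y),
      P.-integrable setT (EFin \o Z),
      measurable_wrt G Z &
      forall A, G A ->
        (\int[P]_(w in A) (Y w)%:E = \int[P]_(w in A) (Z w)%:E)%E].

Record martingale d (Omega : measurableType d) (R : realType)
    (P : probability Omega R) (F : R -> set (set Omega))
    (M : R -> Omega -> R) : Prop := {
  martingale_adapted : forall t, 0 <= t -> measurable_wrt (F t) (M t) ;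
  martingale_integrable : forall t, 0 <= t ->
    P.-integrable setT (EFin \o M t) ;
  martingale_cond : forall s t, 0 <= s -> s <= t ->
    is_cond_expectation P (F s) (M t) (M s) }.

Definition cadlag (R : realType) (f : R -> R) : Prop :=
  (forall t, 0 <= t -> f s @[s --> t^'+] --> f t) /\
  (forall t, 0 < t -> cvg (f s @[s --> t^'-])).

(** The values of [deg] outside [Pol] are irrelevant. *)
Record polynomial_space (R : realType) (E : Type)
    (Pol : submodClosed (E -> R)) (deg : (E -> R) -> nat) : Prop := {
  pol_cst : forall c : R, (fun _ : E => c) \in Pol ;
  degD_le : forall p q, p \in Pol -> q \in Pol ->
    (deg (p + q)%R <= maxn (deg p) (deg q))%N ;
  degZ : forall (a : R) p, a != 0 -> p \in Pol -> deg (a *: p) = deg p ;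
  deg_eq0 : forall p, p \in Pol ->
    (deg p = 0%N <-> exists c : R, p = (fun _ => c)) }.

Definition Pol_le (R : realType) (E : Type) (Pol : submodClosed (E -> R))
    (deg : (E -> R) -> nat) (n : nat) : set (E -> R) :=
  [set p | p \in Pol /\ (deg p <= n)%N].

(** The values of [T h p] for [h < 0] or [p] outside [Pol] are irrelevant. *)
Record polynomial_action (R : realType) (E : Type)
    (Pol : submodClosed (E -> R)) (deg : (E -> R) -> nat)
    (T : R -> (E -> R) -> (E -> R)) : Prop := {
  action_stable : forall h p, 0 <= h -> p \in Pol -> T h p \in Pol ;
  action_linear : forall h a p q, 0 <= h -> p \in Pol -> q \in Pol ->
    T h (a *: p + q) = a *: T h p + T h q ;
  action_deg : forall h p, 0 <= h -> p \in Pol -> (deg (T h p) <= deg p)%N ;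
  action0 : forall p, p \in Pol -> T 0 p = p ;
  actionD : forall h k p, 0 <= h -> 0 <= k -> p \in Pol ->
    T h (T k p) = T (h + k) p ;
  action_right_continuous : forall p x t, p \in Pol -> 0 <= t ->
    T h p x @[h --> t^'+] --> T t p x }.

Record polynomial_process d (Omega : measurableType d) (R : realType)
    (P : probability Omega R) (F : R -> set (set Omega)) (E : Type)
    (Pol : submodClosed (E -> R)) (T : R -> (E -> R) -> (E -> R))
    (X : R -> Omega -> E) : Prop := {
  process_integrable : forall p t, p \in Pol -> 0 <= t ->
    P.-integrable setT (fun w => (p (X t w))%:E) ;
  process_cond : forall p t h, p \in Pol -> 0 <= t -> 0 <= h ->
    is_cond_expectation P (F t)
      (fun w => p (X (t + h) w)) (fun w => T h p (X t w)) ;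
  process_cadlag : forall p w, p \in Pol -> cadlag (fun t => p (X t w)) ;
  process_adapted : forall p t, p \in Pol -> 0 <= t ->
    measurable_wrt (F t) (fun w => p (X t w)) }.

Record strongly_continuous_semigroup (R : realType)
    (V : completeNormedModType R) (S : R -> V -> V) : Prop := {
  semigroup_linear : forall h, 0 <= h -> linear (S h) ;
  semigroup_bounded : forall h, 0 <= h ->
    exists C : R, forall v, `|S h v| <= C * `|v| ;
  semigroup0 : forall v, S 0 v = v ;
  semigroupD : forall h k v, 0 <= h -> 0 <= k -> S h (S k v) = S (h + k) v ;
  semigroup_continuous : forall v,
    {within `[0, +oo[, continuous (fun h => S h v)} }.

Definition generator_domain (R : realType) (V : completeNormedModType R)
    (S : R -> V -> V) : set V :=
  [set v | cvg (h^-1 *: (S h v - v) @[h --> 0^'+])].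

Definition generator (R : realType) (V : completeNormedModType R)
    (S : R -> V -> V) (v : V) : V :=
  lim (h^-1 *: (S h v - v) @[h --> 0^'+]).

(** A complete norm on [Pol_le Pol deg 4] is given by a Banach space [V]
    together with a linear bijection [ev] of [V] onto [Pol_le Pol deg 4]:
    [ev v] is the function [v] stands for, and the norm of [ev v] is [`|v|].
    [restr ev T h] is the restriction of [T h] read through [ev]. *)
Definition restr (R : realType) (E : Type) (V : completeNormedModType R)
    (ev : V -> (E -> R)) (T : R -> (E -> R) -> (E -> R)) (h : R) (v : V) : V :=
  xget 0 [set w | ev w = T h (ev v)].

Record standing_assumption d (Omega : measurableType d) (R : realType)
    (P : probability Omega R) (E : Type) (Pol : submodClosed (E -> R))
    (deg : (E -> R) -> nat) (T : R -> (E -> R) -> (E -> R))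
    (X : R -> Omega -> E) (V : completeNormedModType R)
    (ev : {linear V -> (E -> R)}) : Prop := {
  ev_inj : injective ev ;
  ev_range : range ev = Pol_le Pol deg 4 ;
  restr_semigroup : strongly_continuous_semigroup (restr ev T) ;
  delta_continuous : forall x : E, continuous (fun v : V => ev v x) ;
  Gamma_continuous :
    continuous (fun v : V => fine 'E_P[fun w => ev v (X 0%R w)]) ;
  separates_points : forall x y : E, x <> y ->
    exists2 p, Pol_le Pol deg 1 p & p x <> p y ;
  mul_P1 : forall p q, Pol_le Pol deg 1 p -> Pol_le Pol deg 1 q ->
    Pol_le Pol deg 2 (p \* q) ;
  mul_P2 : forall p q, Pol_le Pol deg 2 p -> Pol_le Pol deg 2 q ->
    Pol_le Pol deg 4 (p \* q) ;
  Pol_le_closed : forall n, (n <= 4)%N -> closed (ev @^-1` Pol_le Pol deg n) }.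

(** The process [p(X_t) - \int_0^t (G p)(X_r) dr] for [p] represented by [v]. *)
Definition Mproc (R : realType) (Omega E : Type)
    (V : completeNormedModType R) (ev : V -> (E -> R))
    (T : R -> (E -> R) -> (E -> R)) (X : R -> Omega -> E)
    (v : V) (t : R) (w : Omega) : R :=
  ev v (X t w) -
  \int[lebesgue_measure]_(r in `[0, t]) ev (generator (restr ev T) v) (X r w).

(* Main.v *)
(* For x in E, the function u |-> (T_u p)(x) is continuous with continuous right
   derivative (T_u (G p))(x), and such a function is the integral of its right
   derivative; hence T_h p - p = \int_0^h T_u (G p) du pointwise on E.  For A in
   F_s, Fubini's theorem and the polynomial property turn the integral of
   G p (X_r) over [s, t] x A into that of T_(r-s) (G p) (X_s), hence, by Fubini
   again and this identity, into the integral over A of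
   T_(t-s) p (X_s) - p (X_s), which is the expected increment of p(X) on A.
   Both uses of Fubini, and square integrability, rest on a bound for
   E[(G p (X_r))^2] that is uniform for r in [0, t]: G p has degree at most 2,
   so q = (G p)^2 lies in P_4 and the moment is Gamma (T_r q), which is
   continuous in r. *)
Require Import Defs.
From HB Require Import structures.
From mathcomp Require Import all_boot all_order all_algebra.
From mathcomp Require Import all_classical all_reals all_analysis.
From mathcomp Require Import ring lra measurable_realfun.
Set Implicit Arguments.
Unset Strict Implicit.
Unset Printing Implicit Defensive.
Import Order.TTheory GRing.Theory Num.Theory.
Import numFieldNormedType.Exports.
Local Open Scope classical_set_scope.
Local Open Scope ring_scope.

(** * Boundedness of cadlag functions on segments *)

Lemma near_left_right (R : realType) (x : R) (Q : R -> Prop) :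
  (\forall y \near x^'-, Q y) -> (\forall y \near x^'+, Q y) -> Q x ->
  \forall y \near x, Q y.
Proof.
move=> hl hr hx.
have {}hl : \forall y \near x, y < x -> Q y by [].
have {}hr : \forall y \near x, x < y -> Q y by [].
near=> y; have [yx|xy|->] := ltgtP y x; last exact: hx.
- by move: yx; near: y.
- by move: xy; near: y.
Unshelve. all: by end_near. Qed.

Lemma cvg_near_normr_le (R : realType) (T : Type) (G : set_system T)
    {FG : Filter G} (f : T -> R) (l : R) : f y @[y --> G] --> l ->
  \forall y \near G, `|f y| <= `|l| + 1.
Proof.
move=> /cvgrPdist_le/(_ 1 ltr01); apply: filterS => y h.
rewrite -lerBlDl; apply: le_trans h; rewrite distrC.
exact: lerB_dist.
Qed.

Lemma cadlag_locally_bounded (R : realType) (f : R -> R) (x : R) :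
  cadlag f -> 0 <= x ->
  exists C, \forall y \near x, 0 <= y -> `|f y| <= C.
Proof.
move=> [fr fl] x0.
have hr : \forall y \near x^'+, `|f y| <= `|f x| + 1.
  exact: cvg_near_normr_le (fr x x0).
(* [cadlag] says nothing to the left of 0; there the guard [0 <= y] makes the left half vacuous. *)
have [x_0|x_0] := eqVneq x 0.
  exists (`|f x| + 1); apply: near_left_right => //.
  - by near=> y => y0; exfalso; have : y < x by []; rewrite x_0 ltNge y0.
  - by apply: filterS hr => y hy _.
  - by move=> _; rewrite lerDl.
have /(fl x)/cvg_ex[l /= lf] : 0 < x by rewrite lt_neqAle eq_sym x_0.
have hl : \forall y \near x^'-, `|f y| <= `|l| + 1.
  exact: cvg_near_normr_le lf.
exists (Num.max (`|l| + 1) (`|f x| + 1)); apply: near_left_right.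
- by apply: filterS hl => y hy _; rewrite le_max hy.
- by apply: filterS hr => y hy _; rewrite le_max hy orbT.
- by move=> _; rewrite le_max lerDl ler01 orbT.
Unshelve. all: by end_near. Qed.

(** Compactness of the segment merges the local bounds into one: the covering property is used along
    the filter of bounds [i] tending to [+oo], because a local bound [C] serves for every larger
    [i]. *)
Lemma cadlag_bounded (R : realType) (f : R -> R) (b : R) : cadlag f ->
  exists C : R, forall x, 0 <= x -> x <= b -> `|f x| <= C.
Proof.
move=> cf.
have /compact_near_coveringP /(_ _ (pinfty_nbhs R) _) : compact `[0, b]%classic.
  exact: segment_compact.
move=> /(_ (fun i x => 0 <= x -> `|f x| <= i)) H.
have {H} : \forall i \near +oo, forall x, `[0, b]%classic x -> 0 <= x ->
    `|f x| <= i.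
  apply: H => x /=; rewrite in_itv/= => /andP[x0 _].
  have [C hC] := cadlag_locally_bounded cf x0.
  exists (([set y | 0 <= y -> `|f y| <= C]), [set i | C <= i]) => /=.
    by split => //; apply: nbhs_pinfty_ge; exact: num_real.
  by move=> [y i] /= [hy hi] y0; exact: le_trans (hy y0) hi.
move=> /filter_ex[C hC]; exists C => x x0 xb; apply: hC => //=.
by rewrite in_itv/= x0.
Unshelve. all: by end_near. Qed.

(** * Joint measurability and Fubini for right-continuous processes *)

(** The process is the pointwise limit of its values at grid points to the right of [r]. For a fixed
    mesh, the preimage of a measurable set is a countable union of rectangles, one for each grid
    interval. *)
Lemma right_continuous_measurable (R : realType) d (S : measurableType d)
    (Z : R -> S -> R) : (forall r, measurable_fun setT (Z r)) ->
  (forall w r, Z u w @[u --> r^'+] --> Z r w) ->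
  measurable_fun setT (fun z : measurableTypeR R * S => Z z.1 z.2).
Proof.
move=> mZ Zr.
(* The [+ 1] puts the grid point strictly to the right of [r] even when [r] lies on the grid, as
   [r^'+] excludes [r] itself. *)
pose c (n : nat) (r : R) : R := ((Num.floor (r * n.+1%:R))%:~R + 1) / n.+1%:R.
have c_gt n r : r < c n r.
  by rewrite /c ltr_pdivlMr// -[X in _ < _ + X]/(1%:~R) -intrD floorD1_gt // .
have c_le n r : c n r <= r + n.+1%:R^-1.
  rewrite /c ler_pdivrMr// mulrDl mulVf// lerD2r.
  exact: floor_le.
apply: (@measurable_fun_cvg _ _ _ setT
  (fun n (z : measurableTypeR R * S) => Z (c n z.1) z.2)).
  move=> n _ B mB; rewrite setTI.
  rewrite [X in measurable X](_ : _ = \bigcup_(k : int)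
     ([set r : R | Num.floor (r * n.+1%:R) = k] `*`
       (Z ((k%:~R + 1) / n.+1%:R) @^-1` B))); last first.
    apply/seteqP; split=> [[r w] /= h|[r w] [k _ [/= <-]]//].
    by exists (Num.floor (r * n.+1%:R)).
  apply: countable_bigcupT_measurable => [|k]; first exact: countableP.
  apply: measurableX; last by rewrite -[X in measurable X]setTI; exact: mZ.
  rewrite [X in measurable X](_ : _ =
    `[k%:~R / n.+1%:R, (k%:~R + 1) / n.+1%:R[%classic)//.
  apply/seteqP; split => r /=; rewrite in_itv/= ler_pdivrMr// ltr_pdivlMr//.
    by move=> <-; rewrite floor_le// -[X in _ < _ + X]/(1%:~R) -intrD floorD1_gt.
  by move=> h; apply/eqP; rewrite floor_eq intrD.
move=> [r w] _ /=.
suff h : c n r @[n --> \oo] --> r^'+ by exact: (cvg_comp (c ^~ r) (Z ^~ w) h (Zr w r)).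
have hc : c n r @[n --> \oo] --> r.
  apply: (@squeeze_cvgr _ _ _ _ (cst r) (fun n => r + harmonic n)).
  - by near=> n; rewrite c_le ltW.
  - exact: cvg_cst.
  - by rewrite -[X in _ --> X]addr0; apply: cvgD; [exact: cvg_cst|exact: cvg_harmonic].
move=> A hA.
have {}hc : \forall n \near \oo, r < c n r -> A (c n r) by exact: (hc _ hA).
suff : \forall n \near \oo, A (c n r) by [].
by apply: filterS hc => n; apply; exact: c_gt.
Unshelve. all: by end_near. Qed.

(** By Tonelli the integrals of the positive and negative parts are measurable in the parameter;
    [fine] keeps their difference measurable also where it is infinite. *)
Lemma measurable_fun_Rintegral_param (R : realType) d1 d2
    (T1 : measurableType d1) (T2 : measurableType d2)
    (m1 : {sigma_finite_measure set T1 -> \bar R}) (D : set T1)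
    (f : T1 * T2 -> R) :
  measurable D -> measurable_fun setT f ->
  measurable_fun setT (fun y => \int[m1]_(x in D) f (x, y)).
Proof.
move=> mD mf.
pose g (z : T1 * T2) : \bar R := (f z * \1_D z.1)%:E.
have mg : measurable_fun setT g.
  apply/measurable_EFinP; apply: measurable_funM => //.
  by apply: measurableT_comp => //; exact: measurable_indic.
rewrite (_ : (fun _ => _) = fine \o
    (fun y => \int[m1]_x g^\+ (x, y) - \int[m1]_x g^\- (x, y))%E); last first.
  apply/funext => y /=; rewrite /Rintegral integral_mkcond integralE; congr fine.
  have gE x : ((fun x => (f (x, y))%:E) \_ D) x = g (x, y).
    rewrite patchE /g /= indicE; case: ifP => _; by rewrite ?mulr1 ?mulr0.
  congr (_ - _)%E; apply: eq_integral => x _;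
    by rewrite !(funeposE, funenegE) gE.
apply: measurableT_comp => //; apply: emeasurable_funB.
  apply: (@measurable_fun_fubini_tonelli_G _ _ T1 T2 R m1 g^\+%E) => //.
  exact: measurable_funepos.
apply: (@measurable_fun_fubini_tonelli_G _ _ T1 T2 R m1 g^\-%E) => //.
exact: measurable_funeneg.
Qed.

(** Multiplication by both indicators reduces this to Fubini on the whole product. Absolute
    integrability comes from the bound [C] on the inner integrals and the finite mass of [D];
    integrability of each section makes the real inner integral agree with the extended one. *)
Lemma Fubini_rect (R : realType) d1 d2
    (T1 : measurableType d1) (T2 : measurableType d2)
    (m1 : {sigma_finite_measure set T1 -> \bar R})
    (m2 : {sigma_finite_measure set T2 -> \bar R})
    (D : set T1) (A : set T2) (f : T1 * T2 -> R) (C : R) :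
  measurable D -> (m1 D < +oo)%E -> measurable A -> measurable_fun setT f ->
  (forall y, m1.-integrable D (fun x => (f (x, y))%:E)) ->
  (forall x, D x -> (\int[m2]_(y in A) `|f (x, y)|%:E <= C%:E)%E) ->
  m2.-integrable A (fun y => (\int[m1]_(x in D) f (x, y))%:E) /\
  (\int[m2]_(y in A) (\int[m1]_(x in D) f (x, y))%:E =
   \int[m1]_(x in D) \int[m2]_(y in A) (f (x, y))%:E)%E.
Proof.
move=> mD Doo mA mf if1 fC.
(* The coordinates are swapped so that [fubini_F] forms the inner integral over [T1], the one whose
   integrability is claimed. *)
pose g (z : T2 * T1) : \bar R := (f (z.2, z.1) * (\1_D z.2 * \1_A z.1))%:E.
have mg : measurable_fun setT g.
  apply/measurable_EFinP; apply: measurable_funM => /=.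
    apply: (measurableT_comp mf) => /=.
    by apply: measurable_fun_pair; [exact: measurable_snd|exact: measurable_fst].
  by apply: measurable_funM; apply: measurableT_comp => //;
    exact: measurable_indic.
have gE x y : g (y, x) = (((fun y => (f (x, y))%:E) \_ A) y * (\1_D x)%:E)%E.
  rewrite patchE /g /= !indicE; case: (y \in A); case: (x \in D) => /=;
  by rewrite ?(mulr1, mulr0, mule1, mule0).
have g12 x : (\int[m2]_y g (y, x))%E =
    ((fun x => \int[m2]_(y in A) (f (x, y))%:E) \_ D)%E x.
  rewrite patchE; case: ifPn => xD.
    rewrite [RHS]integral_mkcond; apply: eq_integral => y _.
    by rewrite gE indicE xD mule1.
  rewrite integral0_eq// => y _; rewrite gE indicE (negbTE xD) mule0//.
have ga12 x : (\int[m2]_y `|g (y, x)|)%E =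
    ((fun x => \int[m2]_(y in A) `|f (x, y)|%:E) \_ D)%E x.
  rewrite patchE; case: ifPn => xD.
    rewrite [RHS]integral_mkcond; apply: eq_integral => y _.
    rewrite gE !patchE indicE xD mule1; case: ifP => _ //=.
    by rewrite normr0.
  rewrite integral0_eq// => y _; rewrite gE indicE (negbTE xD) mule0 abse0//.
have g21 y : (\int[m1]_x g (y, x))%E =
    ((fun y => (\int[m1]_(x in D) f (x, y))%:E) \_ A)%E y.
  rewrite patchE; case: ifPn => yA.
    rewrite /Rintegral fineK; last exact: integrable_fin_num.
    rewrite [RHS]integral_mkcond; apply: eq_integral => x _.
    rewrite gE !patchE indicE yA; case: ifP => _ /=; by rewrite ?mule0 ?mule1.
  rewrite integral0_eq// => x _; rewrite gE patchE (negbTE yA) mul0e//.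
have ig : (m2 \x m1)%E.-integrable setT g.
  apply/integrable21ltyP => //.
  apply: (@le_lt_trans _ _ (\int[m1]_x (C * \1_D x)%:E)%E).
    apply: ge0_le_integral => //=.
    - by move=> x _; apply: integral_ge0.
    - apply: (@measurable_fun_fubini_tonelli_G _ _ _ _ R m2 (abse \o g)).
        exact: measurableT_comp.
      by move=> z; exact: abse_ge0.
    - by apply/measurable_EFinP/measurable_funM => //; exact: measurable_indic.
    - move=> x _; move: (ga12 x); rewrite /g/= => ->; rewrite patchE indicE; case: ifPn => [|_].
        by rewrite inE mulr1; exact: fC.
      by rewrite mulr0.
  rewrite (_ : integral _ _ _ = \int[m1]_(x in D) C%:E)%E; last first.
    rewrite [RHS]integral_mkcond; apply: eq_integral => x _.
    by rewrite patchE indicE; case: ifP; rewrite ?mulr1 ?mulr0.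
  rewrite integral_cst// ltey; have : m1 D \is a fin_num by rewrite ge0_fin_numE.
  by move=> /fineK mDE; rewrite -[X in (_ * X)%E]mDE -EFinM.
split.
  have := integrable_fubini_F ig.
  rewrite /fubini_F; under eq_fun do rewrite g21.
  by rewrite -integrable_mkcond.
have := Fubini ig.
under eq_integral do rewrite g21.
under [X in _ = X -> _]eq_integral do rewrite g12.
by rewrite -!integral_mkcond => ->.
Qed.

Definition right_continuous_on (R : realType) (a b : R) (f : R -> R) : Prop :=
  forall r, a <= r -> r < b -> f u @[u --> r^'+] --> f r.

(** Clamping time extends a process controlled only on [[a, b]] to the whole line. It is constant in
    time before [a] and from [b] on, so right-continuity survives and [right_continuous_measurable]
    applies. *)
Lemma clamped_process_measurable (R : realType) d (S : measurableType d)
    (Z : R -> S -> R) (a b : R) : a <= b ->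
  (forall r, a <= r <= b -> measurable_fun setT (Z r)) ->
  (forall w, right_continuous_on a b (Z ^~ w)) ->
  measurable_fun setT (fun z : measurableTypeR R * S =>
    Z (Num.min b (Num.max a z.1)) z.2).
Proof.
move=> ab mZ Zr.
apply: (right_continuous_measurable
  (Z := fun r w => Z (Num.min b (Num.max a r)) w)) => [r|w r].
  by apply: mZ; rewrite le_min ab le_max lexx ge_min lexx.
have [ra|ar] := ltP r a.
  apply: cvg_near_cst; near=> u.
  have ua : u < a by near: u; exact: nbhs_right_lt.
  by rewrite (max_l (ltW ua)).
have [rb|br] := ltP r b; last first.
  apply: cvg_near_cst; near=> u.
  have ru : r < u by [].
  by rewrite max_r ?(le_trans ar (ltW ru))// min_l// (le_trans br (ltW ru)).
apply: (cvg_trans _ (Zr w r ar rb)); apply: near_eq_cvg; near=> u.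
have ru : r < u by [].
have ub : u < b by near: u; exact: nbhs_right_lt.
by rewrite max_r ?(le_trans ar (ltW ru))// min_r// ltW.
Unshelve. all: by end_near. Qed.

Lemma measurable_time_integral (R : realType) d (S : measurableType d)
    (Z : R -> S -> R) (a b : R) : a <= b ->
  (forall r, a <= r <= b -> measurable_fun setT (Z r)) ->
  (forall w, right_continuous_on a b (Z ^~ w)) ->
  measurable_fun setT (fun w => \int[lebesgue_measure]_(r in `[a, b]) Z r w).
Proof.
move=> ab mZ Zr.
have mc := clamped_process_measurable ab mZ Zr.
have := @measurable_fun_Rintegral_param R _ _ _ _ lebesgue_measure
  `[a, b]%classic _ (measurable_itv _) mc.
congr measurable_fun; apply/funext => w; apply: eq_Rintegral => r /=.
by rewrite inE/= in_itv/= => /andP[ar rb]; rewrite (max_r ar) (min_r rb).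
Qed.

Lemma Fubini_time_integral (R : realType) d (S : measurableType d)
    (P : probability S R) (Z : R -> S -> R) (a b C : R) (A : set S) : a <= b ->
  measurable A ->
  (forall r, a <= r <= b -> measurable_fun setT (Z r)) ->
  (forall w, right_continuous_on a b (Z ^~ w)) ->
  (forall w, lebesgue_measure.-integrable `[a, b] (fun r => (Z r w)%:E)) ->
  (forall r, a <= r <= b -> (\int[P]_w `|Z r w|%:E <= C%:E)%E) ->
  P.-integrable A
    (fun w => (\int[lebesgue_measure]_(r in `[a, b]) Z r w)%:E) /\
  (\int[P]_(w in A) (\int[lebesgue_measure]_(r in `[a, b]) Z r w)%:E =
   \int[lebesgue_measure]_(r in `[a, b]) \int[P]_(w in A) (Z r w)%:E)%E.
Proof.
move=> ab mA mZ Zr iZ ZC.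
have mc := clamped_process_measurable ab mZ Zr.
have clE r : r \in `[a, b]%classic -> Num.min b (Num.max a r) = r.
  by rewrite inE/= in_itv/= => /andP[ar rb]; rewrite (max_r ar) (min_r rb).
have muab : (lebesgue_measure `[a, b]%classic < +oo)%E.
  by rewrite lebesgue_measure_itv/=; case: ifP => _; rewrite -?EFinD ltry.
have := @Fubini_rect R _ _ _ _ lebesgue_measure P
  `[a, b]%classic A _ C (measurable_itv _) muab mA mc.
have -> : (fun w => (\int[lebesgue_measure]_(r in `[a, b])
    Z (Num.min b (Num.max a r)) w)%:E) =
  (fun w => (\int[lebesgue_measure]_(r in `[a, b]) Z r w)%:E).
  by apply/funext => w; congr EFin; apply: eq_Rintegral => r /clE ->.
have -> : (\int[lebesgue_measure]_(r in `[a, b])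
    \int[P]_(w in A) (Z (Num.min b (Num.max a r)) w)%:E =
  \int[lebesgue_measure]_(r in `[a, b]) \int[P]_(w in A) (Z r w)%:E)%E.
  by apply: eq_integral => r /clE ->.
apply => [w|r /=].
- by apply: eq_integrable (iZ w) => // r /clE ->.
- move=> rab; rewrite clE ?inE//; apply: le_trans (ZC r _) => //.
  apply: ge0_subset_integral => //.
  by apply/measurable_EFinP; apply: measurableT_comp => //; exact: mZ.
Qed.

(** * Recovering a continuous function from its continuous right derivative *)

Definition has_right_derivative (R : realType) (f : R -> R) (r l : R) : Prop :=
  h^-1 * (f (h + r) - f r) @[h --> 0^'+] --> l.

Lemma right_derivative0_le (R : realType) (f : R -> R) (a b e : R) :
  a <= b -> 0 < e ->
  (forall x, a <= x <= b -> {for x, continuous f}) ->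
  (forall r, a <= r < b -> has_right_derivative f r 0) ->
  f b - f a <= e * (b - a).
Proof.
move=> ab e0 cf df.
(* The supremum of [{x | g x <= g a}] is attained, and equals [b] because [g]
   has right derivative [- e < 0]. *)
pose g x := f x - e * (x - a).
have cg x : a <= x <= b -> {for x, continuous g}.
  move=> xab; apply: cvgB; first exact: cf.
  by apply: cvgM; [exact: cvg_cst|apply: cvgB; [exact: cvg_id|exact: cvg_cst]].
pose A := [set x | a <= x <= b /\ g x <= g a].
have Aa : A a by split; rewrite ?lexx.
have ubA : has_ubound A by exists b => x [/andP[]].
have sab : a <= sup A <= b.
  rewrite ub_le_sup//=; apply: ge_sup; first by exists a.
  by move=> x [/andP[]].
have As : g (sup A) <= g a.
  rewrite leNgt; apply/negP => gs.
  have /closure_sup/(_ ubA) : A !=set0 by exists a.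
  move=> /(_ [set x | g a < g x]) /(_ (cvgr_gt _ (cg _ sab) _ gs)).
  by move=> [x [[_ ]]] /=; rewrite leNgt => /negP.
have [sb|bs] := ltP (sup A) b; last first.
  have sE : sup A = b by apply/eqP; rewrite eq_le bs andbT; case/andP: sab.
  by move: As; rewrite sE /g subrr mulr0 subr0 lerBlDr addrC -lerBlDr => ?; lra.
have /df/cvgr_lt/(_ _ e0) hd : a <= sup A < b by rewrite sb; case/andP: sab => ->.
have hb : \forall h \near 0^'+, h < b - sup A.
  by apply: nbhs_right_lt; rewrite subr_gt0.
have : \forall h \near (0 : R)^'+, False.
  near=> h.
  have h0 : 0 < h by [].
  have hlt : h < b - sup A by near: h.
  have : h^-1 * (f (h + sup A) - f (sup A)) < e by near: h.
  rewrite mulrC ltr_pdivrMr// => fh.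
  have : A (h + sup A).
    split; first by case/andP: sab => asA _; apply/andP; split; lra.
    by move: As; rewrite /g; lra.
  by move=> /(ub_le_sup ubA); lra.
by move=> /filter_ex[].
Unshelve. all: by end_near. Qed.

(** The one-sided estimate, applied to [f] and to [- f], bounds the increment by [e * (b - a)] for
    every [e > 0]. *)
Lemma right_derivative0_cst (R : realType) (f : R -> R) (a b : R) : a <= b ->
  (forall x, a <= x <= b -> {for x, continuous f}) ->
  (forall r, a <= r < b -> has_right_derivative f r 0) ->
  f b = f a.
Proof.
move=> ab cf df.
have cNf x : a <= x <= b -> {for x, continuous (fun x => - f x)}.
  by move=> xab; apply: cvgN; exact: cf.
have dNf r : a <= r < b -> has_right_derivative (fun x => - f x) r 0.
  move=> /df; rewrite /has_right_derivative => /cvgN; rewrite oppr0.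
  by apply: cvg_trans; apply: near_eq_cvg; near=> h; rewrite ?fctE /=; ring.
have H e : 0 < e -> `|f b - f a| <= e * (b - a).
  move=> e0; have := right_derivative0_le ab e0 cf df.
  have := right_derivative0_le ab e0 cNf dNf.
  by rewrite ler_norml => ? ?; apply/andP; split; lra.
apply/eqP; rewrite -subr_eq0 -normr_le0; apply/ler_addgt0Pl => e e0.
(* The [+ 1] in the denominator covers the case [a = b]. *)
rewrite addr0; have c0 : 0 < e / (b - a + 1) by rewrite divr_gt0//; lra.
apply: le_trans (H _ c0) _.
by rewrite mulrAC ler_pdivrMr ?ler_pM2l//; lra.
Unshelve. all: by end_near. Qed.

(** Subtracting from [f] a primitive [F] of [f'] leaves a continuous function with zero right
    derivative, hence equal values at [a] and [b]. *)
Lemma integral_right_derivative (R : realType) (f f' : R -> R) (a b : R) :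
  a <= b -> continuous f' ->
  (forall x, a <= x <= b -> {for x, continuous f}) ->
  (forall r, a <= r < b -> has_right_derivative f r (f' r)) ->
  \int[lebesgue_measure]_(r in `[a, b]) f' r = f b - f a.
Proof.
move=> ab cf' cf df.
have intf' (x y : R) : lebesgue_measure.-integrable `[x, y] (EFin \o f').
  apply: continuous_compact_integrable; first exact: segment_compact.
  exact: continuous_subspaceT.
(* Starting the primitive at [a - 1] makes [a] an interior point, so that [F] has a two-sided
   derivative there too. *)
pose F x := \int[lebesgue_measure]_(t in `[a - 1, x]) f' t.
have dF x : a <= x <= b -> derivable F x 1 /\ F^`()%classic x = f' x.
  move=> /andP[ax xb].
  apply: (@continuous_FTC1_closed _ f' (a - 1) x (x + 1)) => //; try lra.
  exact: cf'.
suff : f b - F b = f a - F a.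
  have := @Rintegral_itvB _ f' (BLeft (a - 1)) (BRight b) a (intf' _ _).
  rewrite !bnd_simp => /(_ ltac:(lra) ab).
  rewrite Rintegral_itv_obnd_cbnd; last first.
    apply: integrableS (intf' a b) => //; exact: subset_itv_oc_cc.
  by rewrite -/(F a) -/(F b); lra.
apply: (right_derivative0_cst (f := fun x => f x - F x)) => //.
  move=> x xab; apply: cvgB; first exact: cf.
  apply: differentiable_continuous; apply/derivable1_diffP.
  exact: (dF x xab).1.
move=> r /andP[ar rb].
have /dF[dFr Fr] : a <= r <= b by rewrite ar ltW.
have {}Fr : has_right_derivative F r (f' r).
  apply: cvg_dnbhs_at_right; rewrite -Fr; move: dFr; rewrite /derivable /=.
  rewrite (_ : (fun h : R => _) = fun h => h^-1 * (F (h + r) - F r))//.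
  by apply/funext => h; rewrite /GRing.scale/= mulr1.
rewrite /has_right_derivative -[X in _ --> X](subrr (f' r)).
have dfr : has_right_derivative f r (f' r) by apply: df; rewrite ar.
move: dfr Fr; rewrite /has_right_derivative => dfr Fr.
have := cvgB dfr Fr => /(_ (at_right_proper_filter (0 : R))).
apply: cvg_trans.
by apply: near_eq_cvg; near=> h; rewrite ?fctE /=; ring.
Unshelve. all: by end_near. Qed.

(** * Conditional expectations *)

Lemma measurable_wrtW (R : realType) d (Omega : measurableType d)
    (G : set (set Omega)) (f : Omega -> R) :
  sigma_algebra setT G -> G `<=` measurable -> measurable_wrt G f ->
  measurable_fun setT f.
Proof.
move=> sG Gm mf _ B mB; apply: Gm.
by have := mf measurableT B mB; rewrite /measurable/= sigma_algebra_id.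
Qed.

(** Split the space by the sign of [Z], an event of [G]. On each piece the integral of [|Z|] is the
    absolute value of the integral of [Z], which equals that of [Y]. *)
Lemma cond_expectation_normr_le (R : realType) d (Omega : measurableType d)
    (P : probability Omega R) (G : set (set Omega)) (Y Z : Omega -> R) :
  sigma_algebra setT G -> G `<=` measurable -> is_cond_expectation P G Y Z ->
  (\int[P]_w `|Z w|%:E <= \int[P]_w `|Y w|%:E)%E.
Proof.
move=> sG Gm [iY iZ mZ YZ].
pose A := Z @^-1` `[0, +oo[%classic.
have GA : G A.
  have := mZ measurableT `[0, +oo[%classic (measurable_itv _).
  by rewrite setTI /measurable/= sigma_algebra_id.
have GAC : G (~` A) by rewrite -setTD; case: sG => _ sD _; exact: sD.
have mY : measurable_fun setT (fun w => (Y w)%:E) by case/integrableP : iY.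
have split_int (f : Omega -> R) : measurable_fun setT (EFin \o f) ->
  (\int[P]_w `|f w|%:E =
   \int[P]_(w in A) `|f w|%:E + \int[P]_(w in ~` A) `|f w|%:E)%E.
  move=> mf; rewrite -{1}(setUv A) ge0_integral_setU ?setUv//.
  - exact: Gm.
  - exact: Gm.
  - apply/measurable_EFinP; apply: measurableT_comp => //.
    exact/measurable_EFinP.
  - by apply/disj_setPS; rewrite setICr.
have part_le B : G B -> (\int[P]_(w in B) `|Z w|%:E =
    `|\int[P]_(w in B) (Z w)%:E|)%E ->
  (\int[P]_(w in B) `|Z w|%:E <= \int[P]_(w in B) `|Y w|%:E)%E.
  move=> GB ->; rewrite -YZ//; apply: le_abse_integral; first exact: Gm.
  exact: measurable_funTS.
rewrite !split_int//; last by case/integrableP : iZ.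
apply: leeD; apply: part_le => //.
  rewrite gee0_abs; last by apply: integral_ge0 => w; rewrite /A/= in_itv/= andbT.
  apply: eq_integral => w; rewrite inE /A/= in_itv/= andbT => w0.
  by rewrite ger0_norm.
rewrite (_ : (\int[P]_(w in ~` A) (Z w)%:E)%E =
    (\int[P]_(w in ~` A) - `|Z w|%:E)%E).
  by rewrite integral_ge0N// abseN gee0_abs//; apply: integral_ge0.
apply: eq_integral => w; rewrite inE /A/= in_itv/= andbT => /negP.
by rewrite -ltNge => w0; rewrite ltr0_norm// opprK.
Qed.

(** * Continuity of clamped paths and limits through bounded operators *)

(** Semigroup paths are continuous on [[0, +oo[] only; freezing them at time 0 before [s] gives
    functions continuous on the whole line, as [integral_right_derivative] asks of [f']. *)
Lemma clamped_continuous (R : realType) (V : topologicalType) (f : R -> V)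
    (s : R) : {within `[0, +oo[, continuous f} ->
  continuous (fun r : R => f (Num.max 0 (r - s))).
Proof.
move=> /subspace_continuousP cf r.
have r0 : `[0, +oo[%classic (Num.max 0 (r - s)).
  by rewrite /= in_itv/= le_max lexx.
apply: (cvg_comp (fun r => Num.max 0 (r - s)) f _ (cf _ r0)).
have : Num.max 0 (u - s) @[u --> r] --> Num.max 0 (r - s).
  apply: (@continuous_max R R (cst 0) (fun u => u - s)); first exact: cvg_cst.
  by apply: cvgB; [exact: cvg_id|exact: cvg_cst].
move=> h A hA; have {}h : \forall u \near r,
    `[0, +oo[%classic (Num.max 0 (u - s)) -> A (Num.max 0 (u - s)).
  exact: (h _ hA).
suff : \forall u \near r, A (Num.max 0 (u - s)) by [].
by apply: filterS h => u; apply; rewrite /= in_itv/= le_max lexx.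
Qed.

Lemma bounded_linear_cvg (R : realType) (V : normedModType R) (L : V -> V)
    (C : R) (T : Type) (G : set_system T) {FG : Filter G} (f : T -> V) (l : V) :
  linear L -> (forall v, `|L v| <= C * `|v|) -> f x @[x --> G] --> l ->
  L (f x) @[x --> G] --> L l.
Proof.
move=> linL LC /cvgrPdist_le fl; apply/cvgrPdist_le => e e0.
(* The constant [C] may be zero or negative, hence [|C| + 1] as the divisor. *)
have C0 : 0 < `|C| + 1 by rewrite ltr_wpDl.
have := fl _ (divr_gt0 e0 C0); apply: filterS => x; rewrite ler_pdivlMr// => h.
rewrite (_ : L l - L (f x) = L (l - f x)); last first.
  have -> : l - f x = -1 *: f x + l by rewrite scaleN1r addrC.
  by rewrite linL scaleN1r addrC.
apply: le_trans (LC _) (le_trans _ h); rewrite mulrC ler_wpM2l//.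
by rewrite (le_trans (ler_norm _))// lerDl.
Qed.

Lemma measurable_wrt_mono (R : realType) (Omega : pointedType)
    (G H : set (set Omega)) (f : Omega -> R) :
  G `<=` H -> measurable_wrt G f -> measurable_wrt H f.
Proof.
move=> GH mf _ B mB; have := mf measurableT B mB.
exact: (sub_sigma_algebra2 GH).
Qed.

(** * Integrals of cadlag functions over time segments *)

Lemma continuous_cadlag (R : realType) (f : R -> R) : continuous f -> cadlag f.
Proof.
move=> cf; split=> t _; first by apply: cvg_at_right_filter; exact: cf.
by apply/cvg_ex; exists (f t); apply: cvg_at_left_filter; exact: cf.
Qed.

Lemma lebesgue_measure_segment_lty (R : realType) (a b : R) :
  (lebesgue_measure `[a, b]%classic < +oo :> \bar R)%E.
Proof. by rewrite lebesgue_measure_itv/=; case: ifP; rewrite -?EFinD ltry. Qed.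

Lemma cadlag_integrable (R : realType) (f : R -> R) (a b : R) :
  0 <= a -> cadlag f -> lebesgue_measure.-integrable `[a, b] (EFin \o f).
Proof.
move=> a0 cf; have [ab|ba] := leP a b; last first.
  by rewrite set_itv_ge ?bnd_simp -?ltNge//; exact: integrable_set0.
apply: measurable_bounded_integrable => //.
- exact: lebesgue_measure_segment_lty.
(* For measurability, [f] is seen as a process that ignores its sample point; composing with the
   diagonal then returns a function of time alone. *)
- have := @clamped_process_measurable R _ (measurableTypeR R) (fun r _ => f r)
    a b ab.
  move=> /(_ (fun r _ => measurable_cst _)) mf.
  have {}mf := mf (fun _ r ar _ => cf.1 r (le_trans a0 ar)).
  have mp : measurable_fun setT (fun r : measurableTypeR R => (r, r)).
    exact: measurable_fun_pair.
  have {mf mp} := measurableT_comp mf mp.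
  move=> /(measurable_funS measurableT (@subsetT _ `[a, b]%classic)).
  apply: eq_measurable_fun => r; rewrite inE/= in_itv/= => /andP[ar rb].
  by rewrite (max_r ar) (min_r rb).
- have [C fC] := cadlag_bounded b cf.
  exists C; split; first exact: num_real.
  move=> M CM r; rewrite /= in_itv/= => /andP[ar rb].
  exact: le_trans (fC r (le_trans a0 ar) rb) (ltW CM).
Qed.

Lemma cadlagX2 (R : realType) (f : R -> R) :
  cadlag f -> cadlag (fun t => f t ^+ 2).
Proof.
move=> [fr fl]; split=> t t0; first by apply: cvgM; exact: fr.
have /cvg_ex[l hl] := fl t t0.
by apply/cvg_ex; exists (l * l); exact: cvgM.
Qed.

(* Integrating [2 c f - c ^ 2 <= f ^ 2] for [c = (\int f) / (b + 1)]. *)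
Lemma sqr_Rintegral_le (R : realType) (f : R -> R) (b : R) : 0 <= b ->
  lebesgue_measure.-integrable `[0, b] (EFin \o f) ->
  lebesgue_measure.-integrable `[0, b] (fun r => (f r ^+ 2)%:E) ->
  (\int[lebesgue_measure]_(r in `[0, b]) f r) ^+ 2 <=
  (b + 1) * \int[lebesgue_measure]_(r in `[0, b]) (f r ^+ 2).
Proof.
move=> b0 intf intf2; set I := Rintegral _ _ _; set J := Rintegral _ _ _.
(* Dividing by [b + 1] rather than [b] allows [b = 0]. The integrated inequality becomes
   [c ^ 2 * (b + 2) <= J], while [I ^ 2 = c ^ 2 * (b + 1) ^ 2]. *)
pose c := I / (b + 1).
have IE : I = c * (b + 1) by rewrite /c divfK//; lra.
have intcst (k : R) :
    lebesgue_measure.-integrable `[0, b] (EFin \o (fun=> k)).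
  apply: cadlag_integrable => //; apply: continuous_cadlag.
  by move=> ?; exact: cvg_cst.
have intcf : lebesgue_measure.-integrable `[0, b] (EFin \o (fun r => 2 * c * f r)).
  rewrite (_ : _ \o _ = fun r => ((2 * c)%:E * (f r)%:E)%E)//.
  exact: integrableZl.
have : \int[lebesgue_measure]_(r in `[0, b]) (2 * c * f r - c ^+ 2) <= J.
  apply: le_Rintegral => //.
    have := integrableB _ intcf (intcst (c ^+ 2)).
    by move=> /(_ (measurable_itv _)); apply: eq_integrable.
  by move=> r _; have := sqr_ge0 (f r - c); rewrite sqrrB; lra.
rewrite RintegralB// RintegralZl// Rintegral_cst// -/I.
rewrite [X in fine X](_ : _ = b%:E) /= ?IE => [h|].
  have := sqr_ge0 c; nra.
rewrite [LHS](lebesgue_measure_itv `[0, b])/= lte_fin; case: ltP => [_|b0'].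
  by rewrite -EFinD subr0.
by congr EFin; lra.
Qed.

(** * The semigroup on polynomials of degree at most 4, read through [ev] *)

Section polynomial_process.
Context (R : realType) (d : measure_display)
  (Omega : measurableType d) (P : probability Omega R)
  (F : R -> set (set Omega)) (hF : filtration F)
  (E : Type) (Pol : submodClosed (E -> R)) (deg : (E -> R) -> nat)
  (hPol : polynomial_space Pol deg)
  (T : R -> (E -> R) -> (E -> R)) (hT : polynomial_action Pol deg T)
  (X : R -> Omega -> E) (hX : polynomial_process P F Pol T X)
  (V : completeNormedModType R) (ev : {linear V -> (E -> R)})
  (hA : standing_assumption P Pol deg T X ev).

Let S : R -> V -> V := restr ev T.
Let g (p : V) : V := generator S p.

Lemma Pol_le_ev v : Pol_le Pol deg 4 (ev v).
Proof. by rewrite -(ev_range hA); exists v. Qed.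

Lemma ev_Pol v : ev v \in Pol.
Proof. by case: (Pol_le_ev v). Qed.

Lemma ev_onto f : Pol_le Pol deg 4 f -> exists v, ev v = f.
Proof. by rewrite -(ev_range hA) => -[v _ <-]; exists v. Qed.

(** The action does not raise degrees, so the preimage sought by [xget] in [restr] exists and the
    default 0 is never returned. *)
Lemma ev_restr h v : 0 <= h -> ev (S h v) = T h (ev v).
Proof.
move=> h0; have [w hw] : exists w, ev w = T h (ev v).
  apply: ev_onto; split; first exact: (action_stable hT h0 (ev_Pol v)).
  by apply: leq_trans (action_deg hT h0 (ev_Pol v)) _; case: (Pol_le_ev v).
by rewrite /S /restr; case: xgetP => [y -> //|/(_ w)].
Qed.

Lemma Pol_leZB n (a : R) f f' :
  Pol_le Pol deg n f -> Pol_le Pol deg n f' -> Pol_le Pol deg n (a *: (f - f')).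
Proof.
move=> [fP fn] [fP' fn'].
have NP' : - f' \in Pol by rewrite -scaleN1r rpredZ.
have BP : f - f' \in Pol by rewrite rpredD.
have Bn : (deg (f - f')%R <= n)%N.
  apply: leq_trans (degD_le hPol fP NP') _; rewrite geq_max fn/=.
  by rewrite -scaleN1r (degZ hPol)// oppr_eq0 oner_eq0.
split; first by rewrite rpredZ.
(* [degZ] covers nonzero scalars only; for [a = 0] the result is a constant, of degree 0. *)
have [->|a0] := eqVneq a 0; last by rewrite (degZ hPol).
rewrite scale0r; suff -> : deg 0 = 0%N by [].
by apply/(deg_eq0 hPol); [exact: rpred0|exists 0].
Qed.

Lemma evaluation_continuous (x : E) : continuous (fun v : V => ev v x).
Proof. exact: (delta_continuous hA). Qed.

(** * The generator and the integral identity for semigroup paths *)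

Section generator_domain.
Context (p : V) (hpC : generator_domain S p).

Lemma generator_cvg : h^-1 *: (S h p - p) @[h --> 0^'+] --> g p.
Proof. by []. Qed.

(** The difference quotients stay among the polynomials of degree at most [n], a closed set, so
    their limit does too. *)
Lemma generator_Pol_le n : (n <= 4)%N ->
  Pol_le Pol deg n (ev p) -> Pol_le Pol deg n (ev (g p)).
Proof.
move=> n4 pn.
apply: (closed_cvg (ev @^-1` Pol_le Pol deg n) (Pol_le_closed hA n4) _ _
  generator_cvg).
near=> h; have h0 : 0 <= h by apply: ltW.
rewrite /preimage /= linearZ linearB; apply: Pol_leZB => //.
rewrite ev_restr//; case: pn => pP pn; split; first exact: (action_stable hT).
by apply: leq_trans pn; exact: (action_deg hT).
Unshelve. all: by end_near. Qed.

Lemma semigroup_path_continuous (v : V) (x : E) (s : R) :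
  continuous (fun r : R => ev (S (Num.max 0 (r - s)) v) x).
Proof.
have cS := clamped_continuous (s := s) (semigroup_continuous (v := v) (restr_semigroup hA)).
have cev : continuous (fun v => ev v x) by exact: evaluation_continuous.
by move=> r; exact: (cvg_comp _ (fun v => ev v x) (cS r) (cev _)).
Qed.

(** For [h > 0] the increment of the path factors as [S (r - s) (S h p - p)], and the bounded
    operator [S (r - s)] and evaluation at [x] both pass to the limit. *)
Lemma semigroup_right_derivative (x : E) (s r : R) : s <= r ->
  has_right_derivative (fun r => ev (S (Num.max 0 (r - s)) p) x) r
    (ev (S (Num.max 0 (r - s)) (g p)) x).
Proof.
move=> sr; rewrite max_r ?subr_ge0//.
have rs0 : 0 <= r - s by rewrite subr_ge0.
have [C SC] := semigroup_bounded (restr_semigroup hA) rs0.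
have Sg : S (r - s) (h^-1 *: (S h p - p)) @[h --> 0^'+] --> S (r - s) (g p).
  apply: bounded_linear_cvg SC generator_cvg.
  exact: (semigroup_linear (restr_semigroup hA)).
have : ev (S (r - s) (h^-1 *: (S h p - p))) x @[h --> 0^'+]
    --> ev (S (r - s) (g p)) x.
  have cev : continuous (fun v => ev v x) by exact: evaluation_continuous.
  exact: (cvg_comp (fun h => S (r - s) (h^-1 *: (S h p - p)))
    (fun v => ev v x) Sg (cev _)).
apply: cvg_trans; apply: near_eq_cvg; near=> h.
have h0 : 0 < h by [].
rewrite max_r; last lra.
have linS : linear (S (r - s)) by exact: (semigroup_linear (restr_semigroup hA)).
have -> : S (h + r - s) p = S (r - s) (S h p).
  rewrite /S (semigroupD (restr_semigroup hA))// ?ltW//.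
  by congr restr; ring.
have SB u v : S (r - s) (u - v) = S (r - s) u - S (r - s) v.
  have -> : u - v = -1 *: v + u by rewrite scaleN1r addrC.
  by rewrite linS scaleN1r [RHS]addrC.
have SZ a u : S (r - s) (a *: u) = a *: S (r - s) u.
  have S0 : S (r - s) 0 = 0 by rewrite -[in LHS](subrr (0 : V)) SB subrr.
  by rewrite -[a *: u]addr0 linS S0 addr0.
by rewrite (max_r rs0) SZ SB linearZ linearB.
Unshelve. all: by end_near. Qed.

Lemma integral_semigroup_path (x : E) (s t : R) : s <= t ->
  \int[lebesgue_measure]_(r in `[s, t]) ev (S (Num.max 0 (r - s)) (g p)) x =
  ev (S (t - s) p) x - ev p x.
Proof.
move=> st.
rewrite (@integral_right_derivative R
  (fun r => ev (S (Num.max 0 (r - s)) p) x))//.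
- rewrite subrr maxxx max_r ?subr_ge0//.
  by rewrite {2}/S (semigroup0 (restr_semigroup hA)).
- exact: semigroup_path_continuous.
- by move=> r _; exact: semigroup_path_continuous.
- by move=> r /andP[sr _]; exact: semigroup_right_derivative.
Qed.

End generator_domain.

(** * Measurability and moment bounds of the process *)

Lemma process_path_cadlag v w : cadlag (fun t => ev v (X t w)).
Proof. exact: (process_cadlag hX w (ev_Pol v)). Qed.

Lemma process_integrable_ev v t : 0 <= t ->
  P.-integrable setT (fun w => (ev v (X t w))%:E).
Proof. exact: (process_integrable hX (ev_Pol v)). Qed.

Lemma process_measurable v t : 0 <= t ->
  measurable_fun setT (fun w => ev v (X t w)).
Proof.
move=> t0; apply/measurable_EFinP.
by case/integrableP: (process_integrable_ev v t0).
Qed.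

Lemma process_measurable_wrt v r t : 0 <= r -> r <= t ->
  measurable_wrt (F t) (fun w => ev v (X r w)).
Proof.
move=> r0 rt; apply: measurable_wrt_mono (process_adapted hX (ev_Pol v) r0).
exact: (filtration_mono hF).
Qed.

Lemma second_moment_bounded v b : Pol_le Pol deg 2 (ev v) ->
  exists C : R, forall r, 0 <= r <= b ->
  P.-integrable setT (fun w => (ev v (X r w) ^+ 2)%:E) /\
  (\int[P]_w (ev v (X r w) ^+ 2)%:E <= C%:E)%E.
Proof.
move=> v2; have [q qE] := ev_onto (mul_P2 hA v2 v2).
have qX x : ev q x = ev v x ^+ 2 by rewrite qE expr2.
(* Clamping makes the moment continuous on the whole line, so [cadlag_bounded] bounds it on
   [[0, b]]. *)
pose moment r := fine ('E_P[fun w => ev (S (Num.max 0 (r - 0)) q) (X 0 w)]).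
have cm : continuous moment.
  have cS := clamped_continuous (s := 0)
    (semigroup_continuous (v := q) (restr_semigroup hA)).
  have cG := Gamma_continuous hA.
  by move=> r; exact: (cvg_comp _
    (fun v : V => fine 'E_P[fun w => ev v (X 0%R w)]) (cS r) (cG _)).
have [C mC] := cadlag_bounded b (continuous_cadlag cm).
exists C => r /andP[r0 rb].
have iq := process_integrable_ev q r0.
have iq2 : P.-integrable setT (fun w => (ev v (X r w) ^+ 2)%:E).
  by apply: eq_integrable iq => // w _; rewrite qX.
split => //.
(* Conditioning on [F 0] and integrating over the whole space moves the time [r] from the process
   onto the semigroup. *)
have [_ i0 _ /(_ setT)] := process_cond hX (ev_Pol q) (lexx 0) r0.
rewrite add0r => H.
have {}H : (\int[P]_w (ev v (X r w) ^+ 2)%:E = (moment r)%:E)%E.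
  under eq_integral do rewrite -qX.
  rewrite H; last first.
    have [F1 F2 F3] := filtration_sigma_algebra hF (lexx 0).
    by rewrite -(setD0 setT); exact: F2.
  rewrite /moment unlock fineK subr0 max_r// ev_restr//.
  exact: integrable_fin_num.
by rewrite H lee_fin (le_trans (ler_norm _))// mC.
Qed.

(** Integrate [|y| <= 1 + y ^ 2] against a probability. *)
Lemma first_moment_bounded v b : Pol_le Pol deg 2 (ev v) ->
  exists C : R, forall r, 0 <= r <= b ->
  (\int[P]_w `|ev v (X r w)|%:E <= C%:E)%E.
Proof.
move=> v2; have [C HC] := second_moment_bounded b v2.
exists (1 + C) => r rb; have [i2 C2] := HC r rb.
have r0 : 0 <= r by case/andP: rb.
apply: (@le_trans _ _ (\int[P]_w (1 + (ev v (X r w) ^+ 2)%:E))%E).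
  apply: ge0_le_integral => //.
  - apply/measurable_EFinP; apply: measurableT_comp => //.
    exact: process_measurable.
  - by apply: emeasurable_funD => //; case/integrableP: i2.
  - move=> w _; rewrite -EFinD lee_fin.
    have := sqr_ge0 (`|ev v (X r w)| - 1); rewrite sqrrB real_normK ?num_real//.
    have := normr_ge0 (ev v (X r w)); lra.
rewrite ge0_integralD//=; last by case/integrableP: i2.
  rewrite integral_cst//. rewrite mul1e EFinD; apply: leeD => //.
  exact: probability_le1.
by move=> w _; rewrite lee_fin sqr_ge0.
Qed.

(** * The martingale property and square integrability *)

Section martingale.
Context (p : V) (hpC : generator_domain S p) (hp2 : Pol_le Pol deg 2 (ev p)).

Let Y r w := ev (g p) (X r w).
Let I a b w := \int[lebesgue_measure]_(r in `[a, b]) Y r w.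

Let g2 : Pol_le Pol deg 2 (ev (g p)).
Proof. exact: generator_Pol_le. Qed.

Let Y_right_continuous a b w : 0 <= a -> right_continuous_on a b (Y ^~ w).
Proof.
move=> a0 r ar _; apply: (process_path_cadlag (g p) w).1.
exact: le_trans ar.
Qed.

Lemma generator_path_integrable a b w : 0 <= a ->
  lebesgue_measure.-integrable `[a, b] (fun r => (Y r w)%:E).
Proof. by move=> a0; exact: (cadlag_integrable b a0 (process_path_cadlag _ w)). Qed.

Lemma Fubini_generator a b A : 0 <= a -> a <= b -> measurable A ->
  P.-integrable A (fun w => (I a b w)%:E) /\
  (\int[P]_(w in A) (I a b w)%:E =
   \int[lebesgue_measure]_(r in `[a, b]) \int[P]_(w in A) (Y r w)%:E)%E.
Proof.
move=> a0 ab mA; have [C YC] := first_moment_bounded b g2.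
apply: (@Fubini_time_integral R _ _ P Y a b C) => //.
- by move=> r /andP[ar _]; apply: process_measurable; exact: le_trans ar.
- by move=> w; exact: Y_right_continuous.
- by move=> w; exact: generator_path_integrable.
- by move=> r /andP[ar rb]; apply: YC; rewrite rb (le_trans a0).
Qed.

Lemma Fubini_semigroup s t A : 0 <= s -> s <= t -> measurable A ->
  (\int[P]_(w in A) (ev (S (t - s) p) (X s w) - ev p (X s w))%:E =
   \int[lebesgue_measure]_(r in `[s, t])
     \int[P]_(w in A) (ev (S (r - s) (g p)) (X s w))%:E)%E.
Proof.
move=> s0 st mA; have [C YC] := first_moment_bounded t g2.
pose Z r w := ev (S (Num.max 0 (r - s)) (g p)) (X s w).
have cZ w : continuous (Z ^~ w) by exact: semigroup_path_continuous.
have [] := @Fubini_time_integral R _ _ P Z s t C A st mA.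
- by move=> r _; exact: process_measurable.
- by move=> w r _ _; apply: cvg_at_right_filter; exact: cZ.
- by move=> w; exact: (cadlag_integrable t s0 (continuous_cadlag (cZ w))).
(* [Z r] is a conditional expectation of [Y r] given [F s], so it inherits the first moment bound of
   [Y r]. *)
- move=> r /andP[sr rt]; have rs0 : 0 <= r - s by rewrite subr_ge0.
  apply: le_trans (YC r _); last by rewrite rt (le_trans s0).
  have := process_cond hX (ev_Pol (g p)) s0 rs0.
  rewrite -ev_restr// addrC subrK /Z max_r//.
  apply: cond_expectation_normr_le; first exact: (filtration_sigma_algebra hF).
  exact: (filtration_sub hF).
move=> _ H; transitivity (\int[P]_(w in A)
    (\int[lebesgue_measure]_(r in `[s, t]) Z r w)%:E)%E.
  by apply: eq_integral => w _; rewrite integral_semigroup_path.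
rewrite H; apply: eq_integral => r; rewrite inE/= in_itv/= => /andP[sr _].
by rewrite /Z max_r// subr_ge0.
Qed.

(** Once Fubini has been applied to both sides, the integrands agree for each fixed [r], by
    conditioning on [F s] and testing on [A]. *)
Lemma increment_expectation s t A : 0 <= s -> s <= t -> F s A ->
  (\int[P]_(w in A) (I s t w)%:E =
   \int[P]_(w in A) (ev (S (t - s) p) (X s w) - ev p (X s w))%:E)%E.
Proof.
move=> s0 st FA; have mA := filtration_sub hF s0 FA.
have [_ IE] := Fubini_generator s0 st mA.
apply: (etrans IE); apply: (etrans _ (esym (Fubini_semigroup s0 st mA))).
apply: eq_integral => r; rewrite inE/= in_itv/= => /andP[sr _].
have rs0 : 0 <= r - s by rewrite subr_ge0.
have [_ _ _ /(_ A FA)] := process_cond hX (ev_Pol (g p)) s0 rs0.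
by rewrite -ev_restr// addrC subrK.
Qed.

Lemma time_integral_split s t w : 0 <= s -> s <= t ->
  I 0 t w = I 0 s w + I s t w.
Proof.
move=> s0 st.
have i0 := generator_path_integrable t w (lexx 0).
have := @Rintegral_itvB _ (Y ^~ w) (BLeft 0) (BRight t) s i0.
rewrite !bnd_simp => /(_ s0 st).
rewrite Rintegral_itv_obnd_cbnd; last first.
  apply: integrableS (generator_path_integrable t w s0) => //.
  exact: subset_itv_oc_cc.
by rewrite /I => <-; rewrite addrC subrK.
Qed.

Let M := Mproc ev T X p.

Lemma Mproc_adapted t : 0 <= t -> measurable_wrt (F t) (M t).
Proof.
move=> t0; apply: measurable_funB; first exact: process_measurable_wrt.
(* The sample space is taken with the sigma-algebra [F t], for which every [Y r] with [r <= t] is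
   measurable. *)
apply: (@measurable_time_integral R _ (g_sigma_algebraType (F t)) Y) => //.
  by move=> r /andP[r0 rt]; exact: process_measurable_wrt.
by move=> w; exact: Y_right_continuous.
Qed.

Lemma Mproc_integrable t A : measurable A -> 0 <= t ->
  P.-integrable A (EFin \o M t).
Proof.
move=> mA t0.
have ip := integrableS measurableT mA (@subsetT _ A) (process_integrable_ev p t0).
have := integrableB mA ip (Fubini_generator (lexx 0) t0 mA).1.
by apply: eq_integrable.
Qed.

Lemma Mproc_cond s t : 0 <= s -> s <= t ->
  is_cond_expectation P (F s) (M t) (M s).
Proof.
move=> s0 st; have t0 := le_trans s0 st.
split; [exact: Mproc_integrable|exact: Mproc_integrable|exact: Mproc_adapted|].
move=> A FA; have mA := filtration_sub hF s0 FA.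
have ip v r : 0 <= r -> P.-integrable A (EFin \o (fun w => ev v (X r w))).
  move=> r0.
  exact: integrableS measurableT mA (@subsetT _ A) (process_integrable_ev v r0).
have iI a b : 0 <= a -> a <= b -> P.-integrable A (EFin \o I a b).
  by move=> a0 ab; exact: (Fubini_generator a0 ab mA).1.
(* All the integrals are finite, so the claim is moved to real numbers, where linear arithmetic can
   finish. *)
have MR r : 0 <= r -> (\int[P]_(w in A) (M r w)%:E)%E =
    (\int[P]_(w in A) ev p (X r w) - \int[P]_(w in A) I 0 r w)%:E.
  move=> r0; rewrite -RintegralB//; [|exact: ip|exact: iI].
  rewrite /Rintegral fineK//; apply: integrable_fin_num => //.
  exact: Mproc_integrable.
suff D : \int[P]_(w in A) ev p (X t w) - \int[P]_(w in A) I 0 t w =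
    \int[P]_(w in A) ev p (X s w) - \int[P]_(w in A) I 0 s w.
  by rewrite (etrans (MR t t0) (congr1 EFin D)) -(MR s s0).
have -> : \int[P]_(w in A) I 0 t w =
    \int[P]_(w in A) I 0 s w + \int[P]_(w in A) I s t w.
  rewrite -RintegralD//; [|exact: iI|exact: iI].
  by apply: eq_Rintegral => w _; exact: time_integral_split.
have -> : \int[P]_(w in A) I s t w =
    \int[P]_(w in A) ev (S (t - s) p) (X s w) - \int[P]_(w in A) ev p (X s w).
  rewrite -RintegralB//; [|exact: ip|exact: ip].
  by rewrite /Rintegral increment_expectation.
have ts0 : 0 <= t - s by rewrite subr_ge0.
(* The polynomial property for [p] itself; the two integrals of [S (t - s) p] then cancel. *)
have -> : \int[P]_(w in A) ev p (X t w) =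
    \int[P]_(w in A) ev (S (t - s) p) (X s w).
  have [_ _ _ /(_ A FA)] := process_cond hX (ev_Pol p) s0 ts0.
  by rewrite -ev_restr// addrC subrK /Rintegral => ->.
lra.
Qed.

(** By [(x - y) ^ 2 <= 2 * x ^ 2 + 2 * y ^ 2] and the Cauchy-Schwarz type bound in time, the square
    is dominated by [2 * ev p (X t w) ^ 2 + 2 * (t + 1) * J w]. Here [J] is integrable by Fubini and
    the uniform second moment bound. *)
Lemma Mproc_square_integrable t : 0 <= t ->
  ('E_P[fun w => (`|M t w| ^+ 2)%R] < +oo)%E.
Proof.
move=> t0; have [Cp HCp] := second_moment_bounded t hp2.
have [C HC] := second_moment_bounded t g2.
have tt : 0 <= t <= t by rewrite t0 lexx.
pose J w := \int[lebesgue_measure]_(r in `[0, t]) (Y r w ^+ 2).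
have iY2 w : lebesgue_measure.-integrable `[0, t] (fun r => (Y r w ^+ 2)%:E).
  exact: (cadlag_integrable t (lexx 0) (cadlagX2 (process_path_cadlag (g p) w))).
have iJ : P.-integrable setT (EFin \o J).
  have [] // := @Fubini_time_integral R _ _ P (fun r w => Y r w ^+ 2) 0 t C setT t0.
  - move=> r /andP[r0 rt]; apply: measurable_funX; exact: process_measurable.
  - move=> w r r0 rt; apply: (cadlagX2 (process_path_cadlag (g p) w)).1 => //.
  - move=> r rt; under eq_integral do rewrite ger0_norm ?sqr_ge0//.
    exact: (HC r rt).2.
have idom : P.-integrable setT
    (fun w => (2 * ev p (X t w) ^+ 2 + 2 * (t + 1) * J w)%:E).
  have := integrableD measurableT (integrableZl measurableT 2 (HCp t tt).1)
    (integrableZl measurableT (2 * (t + 1)) iJ).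
  by apply: eq_integrable.
have mM := measurable_wrtW (filtration_sigma_algebra hF t0)
  (filtration_sub hF t0) (Mproc_adapted t0).
rewrite unlock.
have : P.-integrable setT (EFin \o (fun w => `|M t w| ^+ 2)).
  apply: le_integrable idom => //.
    by apply/measurable_EFinP; apply: measurable_funX; exact: measurableT_comp.
  move=> w _ /=; rewrite lee_fin ger0_norm ?exprn_ge0//.
  rewrite real_normK ?num_real//; apply: le_trans _ (ler_norm _).
  have := sqr_Rintegral_le t0 (generator_path_integrable t w (lexx 0)) (iY2 w).
  rewrite -/(I 0 t w) -/(J w).
  have := sqr_ge0 (ev p (X t w) + I 0 t w); rewrite sqrrD.
  have -> : M t w = ev p (X t w) - I 0 t w by [].
  by rewrite sqrrB; lra.
move=> /integrableP[_]; apply: le_lt_trans; apply: ge0_le_integral => //=.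
- by apply/measurable_EFinP; apply: measurable_funX; exact: measurableT_comp.
- apply/measurable_EFinP; apply: measurableT_comp => //.
  by apply: measurable_funX; exact: measurableT_comp.
- by move=> w _; rewrite lee_fin ler_norm.
Qed.

End martingale.
End polynomial_process.

Theorem lemma7p4 (R : realType) (d : measure_display)
  (Omega : measurableType d) (P : probability Omega R)
  (F : R -> set (set Omega)) (hF : filtration F)
  (E : Type) (hE : inhabited E)
  (Pol : submodClosed (E -> R)) (deg : (E -> R) -> nat)
  (hPol : polynomial_space Pol deg)
  (T : R -> (E -> R) -> (E -> R)) (hT : polynomial_action Pol deg T)
  (X : R -> Omega -> E) (hX : polynomial_process P F Pol T X)
  (V : completeNormedModType R) (ev : {linear V -> (E -> R)})
  (hA : standing_assumption P Pol deg T X ev)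
  (p : V) (hpC : generator_domain (restr ev T) p)
  (hp2 : Pol_le Pol deg 2 (ev p)) :
  (forall (t : R) (w : Omega), 0 <= t -> lebesgue_measure.-integrable `[0, t]
     (fun r => (ev (generator (restr ev T) p) (X r w))%:E)) /\
  martingale P F (Mproc ev T X p) /\
  (forall t : R, 0 <= t -> ('E_P[fun w => (`|Mproc ev T X p t w| ^+ 2)%R] < +oo)%E).
Proof.
(* Path integrability ensures that the time integral in [Mproc] is a genuine one and not a default
   value of [Rintegral]. *)
split; first by move=> t w _; exact: (generator_path_integrable hX hA).
split; last exact: (Mproc_square_integrable hF hPol hT hX hA hpC hp2).
split=> [t t0|t t0|s t s0 st].
- exact: (Mproc_adapted hF hX hA).
- exact: (Mproc_integrable hF hPol hT hX hA hpC hp2).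
- exact: (Mproc_cond hF hPol hT hX hA hpC hp2).
Qed.
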